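(* Let $w\in W$. For every reduced word $\mathsf{w}_\circ$ for the longest element $w_\circ$, we have $$\mathbf{B}(w)\,\mathbf{B}(w^{-1})=\mathbf{Z}_w(\mathsf{w}_\circ).$$
   Context: Coxeter setup: $(W,S)$ is a finite irreducible Coxeter system; $\ell$ is Coxeter length; $T$ is the set of reflections (all conjugates of elements of $S$). The (right) weak order on $W$ is: $x\le y$ iff $\ell(y)=\ell(x)+\ell(x^{-1}y)$; it is a semidistributive lattice, and $\lessdot$ denotes its cover relations (so $x\lessdot y$ means $y=xs$ with $s\in S$, $\ell(y)=\ell(x)+1$). $\mathrm{Inv}(w)=\{u\in T:\ell(uw)<\ell(w)\}$. Braid group: $\mathbf{B}_W$ is the (Artin) braid group of $W$, with generators $\mathbf{s}$ ($s\in S$) and the braid relations. For $w\in W$ with reduced word $(s_1,\ldots,s_k)$, $\mathbf{B}(w)=\mathbf{s}_1\cdots\mathbf{s}_k$. Shards: a join-irreducible element $j$ of the weak order (also called a shard) covers a unique element, denoted $j_*$. It corresponds to a polyhedral piece of exactly one reflecting hyperplane, namely the hyperplane $H_t$ of the reflection $t=j\,j_*^{-1}$; we say the shard $j$ is contained in $H_t$. For a cover relation $x\lessdot y$, the shard label $j_{x,y}$ is the unique minimal element of $\{z\in W: z\vee x=y\}$; it is join-irreducible, and is contained in the hyperplane of the reflection $yx^{-1}$. For a reduced word $\mathsf{w}=(s_1,\ldots,s_k)$, set $x_i=s_1\cdots s_i$ and let $\mathrm{Sh}(\mathsf{w})=(j_{x_0,x_1},j_{x_1,x_2},\ldots,j_{x_{k-1},x_k})$.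 For a shard $j$, set $\mathbb{\Sigma}_j=(\mathbf{B}(j)\mathbf{B}(j_* )^{-1})^2$. Given a reduced word $\mathsf{w}_\circ$ for $w_\circ$ and $w\in W$, let $(j_1,\ldots,j_{\ell(w)})$ be the subsequence of $\mathrm{Sh}(\mathsf{w}_\circ)$ consisting of the shards contained in the inversion hyperplanes $H_t$, $t\in\mathrm{Inv}(w)$, of $w$. Define $\mathbf{Z}_w(\mathsf{w}_\circ)=\mathbb{\Sigma}_{j_{\ell(w)}}\cdots\mathbb{\Sigma}_{j_2}\mathbb{\Sigma}_{j_1}$. *)

(* Defs.v *)
From HB Require Import structures.
From mathcomp Require Import all_boot all_fingroup.
From mathcomp Require Import generic_quotient.
From mathcomp Require Import boolp.

Set Implicit Arguments.
Unset Strict Implicit.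
Unset Printing Implicit Defensive.

Local Open Scope group_scope.
Local Open Scope quotient_scope.

(** * Groups given by generators and relations *)

(* (i, true) stands for the generator i and (i, false) for its inverse. *)
Definition sword (I : Type) : Type := seq (I * bool).

Section Presentation.
Variables (I : choiceType) (R : sword I -> sword I -> Prop).

Inductive pres_eq : sword I -> sword I -> Prop :=
  | pres_refl u : pres_eq u u
  | pres_sym u v : pres_eq u v -> pres_eq v u
  | pres_trans u v w : pres_eq u v -> pres_eq v w -> pres_eq u w
  | pres_cat u u' v v' :
      pres_eq u u' -> pres_eq v v' -> pres_eq (u ++ v) (u' ++ v')
  | pres_free i b : pres_eq [:: (i, b); (i, ~~ b)] [::]
  | pres_rel u v : R u v -> pres_eq u v.

Definition pres_eqb : rel (seq (I * bool)) := fun u v => `[< pres_eq u v >].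

Lemma pres_eqb_refl : reflexive pres_eqb.
Proof. by move=> u; apply/asboolP/pres_refl. Qed.

Lemma pres_eqb_sym : symmetric pres_eqb.
Proof. by move=> u v; apply/asboolP/asboolP; apply: pres_sym. Qed.

Lemma pres_eqb_trans : transitive pres_eqb.
Proof.
by move=> v u w /asboolP uv /asboolP vw; apply/asboolP/(pres_trans uv vw).
Qed.

Canonical pres_equiv :=
  EquivRel pres_eqb pres_eqb_refl pres_eqb_sym pres_eqb_trans.

Definition presented : Type := {eq_quot pres_equiv}.
HB.instance Definition _ := Choice.on presented.

Definition pres_class (u : sword I) : presented := \pi_{eq_quot pres_equiv} u.

Lemma pres_classP u v : reflect (pres_class u = pres_class v) (pres_eqb u v).
Proof. exact: (@eqmodP _ pres_equiv u v). Qed.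

Definition pres_repr (x : presented) : sword I := repr x.

Lemma pres_reprK : cancel pres_repr pres_class.
Proof. exact: reprK. Qed.

Definition sword_inv (u : sword I) : sword I :=
  [seq (x.1, ~~ x.2) | x <- rev u].

Definition pres_one : presented := pres_class [::].
Definition pres_mul (x y : presented) : presented :=
  locked (pres_class (pres_repr x ++ pres_repr y)).
Definition pres_inv (x : presented) : presented :=
  locked (pres_class (sword_inv (pres_repr x))).

Lemma pres_reprE u : pres_eq (pres_repr (pres_class u)) u.
Proof. by apply/asboolP/pres_classP; rewrite pres_reprK. Qed.

Lemma pres_classE u v : pres_eq u v -> pres_class u = pres_class v.
Proof. by move=> uv; apply/pres_classP/asboolP. Qed.

Lemma pres_mulE u v : pres_mul (pres_class u) (pres_class v) = pres_class (u ++ v).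
Proof.
by rewrite /pres_mul -lock; apply/pres_classE/pres_cat; apply: pres_reprE.
Qed.

Lemma sword_invK : involutive sword_inv.
Proof.
move=> u; rewrite /sword_inv -map_rev revK -map_comp.
by rewrite -[RHS]map_id; apply: eq_map => -[i b] /=; rewrite negbK.
Qed.

Lemma sword_mulV u : pres_eq (u ++ sword_inv u) [::].
Proof.
elim: u => [|[i b] u IHu]; first exact: pres_refl.
rewrite /sword_inv rev_cons map_rcons -cats1 /= -/(sword_inv u).
rewrite -cat_cons catA -cat1s -!catA.
apply: pres_trans (pres_free i b).
rewrite -[[:: (i, b); _]]/([:: (i, b)] ++ [::] ++ [:: (i, ~~ b)]).
apply: pres_cat (pres_refl _) _; rewrite catA.
exact: pres_cat IHu (pres_refl _).
Qed.

Lemma pres_mulA : associative pres_mul.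
Proof.
move=> x y z; rewrite -(pres_reprK x) -(pres_reprK y) -(pres_reprK z).
by rewrite !pres_mulE catA.
Qed.

Lemma pres_mul1 : left_id pres_one pres_mul.
Proof. by move=> x; rewrite -(pres_reprK x) pres_mulE. Qed.

Lemma pres_mulr1 : right_id pres_one pres_mul.
Proof. by move=> x; rewrite -(pres_reprK x) pres_mulE cats0. Qed.

Lemma pres_mulV : left_inverse pres_one pres_inv pres_mul.
Proof.
move=> x; rewrite -{2}(pres_reprK x) /pres_inv -lock pres_mulE.
apply: pres_classE; rewrite -{2}(sword_invK (pres_repr x)).
exact: sword_mulV.
Qed.

Lemma pres_mulrV : right_inverse pres_one pres_inv pres_mul.
Proof.
move=> x; rewrite -{1}(pres_reprK x) /pres_inv -lock pres_mulE.
exact/pres_classE/sword_mulV.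
Qed.

HB.instance Definition _ := isGroup.Build presented
  pres_mulA pres_mul1 pres_mulr1 pres_mulV pres_mulrV.

Lemma pres_classM u v : pres_class (u ++ v) = pres_class u * pres_class v.
Proof. by rewrite -pres_mulE. Qed.

Definition pres_gen (i : I) : presented := pres_class [:: (i, true)].

End Presentation.

(** * Coxeter systems *)

Section CoxeterSystem.
Variables (W : finGroupType) (S : {set W}).

Definition gens : finType := {s : W | s \in S}.

Definition cox_m (s t : gens) : nat := #[val s * val t].

(* the word s t s t ... with n letters *)
Definition alt_word (s t : gens) (n : nat) : sword gens :=
  mkseq (fun k => (if odd k then t else s, true)) n.

Inductive coxeter_rel : sword gens -> sword gens -> Prop :=
  | CoxeterRel s t : coxeter_rel (alt_word s t (cox_m s t).*2) [::].

Definition sword_eval (u : sword gens) : W :=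
  \prod_(x <- u) (if x.2 then val x.1 else (val x.1)^-1).

(* S generates W, its elements have order 2, and the relations
   (s t)^m(s,t) = 1, with m(s,t) the order of s t, present W. *)
Definition coxeter_system : Prop :=
  [/\ <<S>> = [set: W],
      forall s, s \in S -> #[s] = 2
    & forall u v : sword gens,
        sword_eval u = sword_eval v -> pres_eq coxeter_rel u v].

(* the edges of the Coxeter graph *)
Definition coxeter_edge : rel gens := fun s t => 2 < cox_m s t.

Definition cox_irreducible : Prop :=
  S != set0 /\ forall s t : gens, connect coxeter_edge s t.

Definition word_prod (u : seq gens) : W := \prod_(s <- u) val s.

(* The least n such that w is a product of n elements of S; lengths are smaller
   than #|W| because the prefix products of a shortest word are distinct. *)
Definition cox_len (w : W) : nat :=
  find (fun n => [exists u : n.-tuple gens, word_prod u == w]) (iota 0 #|W|).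

Definition reduced_word (u : seq gens) (w : W) : bool :=
  (word_prod u == w) && (size u == cox_len w).

Definition longest : W := [arg max_(w > 1) cox_len w].

Definition reflections : {set W} := class_support S [set: W].

Definition inversions (w : W) : {set W} :=
  [set u in reflections | cox_len (u * w) < cox_len w].

(** ** Right weak order *)

Definition weak_le (x y : W) : bool :=
  cox_len y == (cox_len x + cox_len (x^-1 * y))%N.

Definition weak_lt (x y : W) : bool := (x != y) && weak_le x y.

Definition weak_cover (x y : W) : bool :=
  weak_lt x y && [forall z, ~~ (weak_lt x z && weak_lt z y)].

Definition weak_is_join (x z y : W) : bool :=
  [&& weak_le x y, weak_le z y &
      [forall u, weak_le x u ==> weak_le z u ==> weak_le y u]].

Definition weak_minimals (A : {set W}) : {set W} :=
  [set z in A | [forall y in A, ~~ weak_lt y z]].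

(* the unique element of A, and the junk value 1 unless #|A| = 1 *)
Definition the_elt (A : {set W}) : W := odflt 1 (unset1 A).

(** ** Shards *)

(* j_*, the unique element covered by a join-irreducible j *)
Definition lower_cover (j : W) : W := the_elt [set x | weak_cover x j].

(* the reflection in the hyperplane that contains the shard j *)
Definition shard_refl (j : W) : W := j * (lower_cover j)^-1.

(* j_{x,y}, for x covered by y *)
Definition shard_label (x y : W) : W :=
  the_elt (weak_minimals [set z | weak_is_join z x y]).

(* scanl lists the prefix products x_1, ..., x_k *)
Definition shard_word (u : seq gens) : seq W :=
  pairmap shard_label 1 (scanl *%g 1 [seq val s | s <- u]).

(** ** The braid group *)

Inductive braid_rel : sword gens -> sword gens -> Prop :=
  | BraidRel s t : s != t ->
      braid_rel (alt_word s t (cox_m s t)) (alt_word t s (cox_m s t)).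

Definition braid_group : groupType := presented braid_rel.

Definition braid_gen (s : gens) : braid_group := pres_gen braid_rel s.

Definition some_reduced_word (w : W) : seq gens :=
  if [pick u : (cox_len w).-tuple gens | reduced_word u w] is Some u
  then tval u else [::].

(* By Matsumoto's theorem the choice of the reduced word is irrelevant. *)
Definition braid_lift (w : W) : braid_group :=
  \prod_(s <- some_reduced_word w) braid_gen s.

Definition Sigma (j : W) : braid_group :=
  (braid_lift j * (braid_lift (lower_cover j))^-1) ^+ 2.

Definition Z_shards (w : W) (u : seq gens) : seq W :=
  [seq j <- shard_word u | shard_refl j \in inversions w].

(* The product is taken from the last shard to the first one. *)
Definition Z_prod (w : W) (u : seq gens) : braid_group :=
  \prod_(j <- rev (Z_shards w u)) Sigma j.

End CoxeterSystem.

(* Main.v *)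
(* For x in W let g(x) = B(w) B(w^-1 x) B(x)^-1, the loop from the identity chamber
   through w and x and back.  Then g(1) = B(w) B(w^-1), and g(w0) = 1 because
   w <= w0 in the weak order.  Along a cover x < xs with reflection t = x s x^-1 the
   value of g does not change if t is not an inversion of w, and otherwise
   g(x) = g(xs) (B(xs) B(x)^-1)^2.  It remains to see that B(xs) B(x)^-1 depends only
   on the shard label of the cover: the label is the unique minimal element below xs
   with inversion t, and it is reached from xs by passing repeatedly to the opposite
   edge of a rank two interval, which does not change B(xs) B(x)^-1 by the braid
   relations.  Uniqueness of the minimal element is Newman's lemma. *)

From mathcomp Require Import all_boot all_fingroup.
From mathcomp Require Import cyclic boolp.
Require Import Defs.

Set Implicit Arguments.
Unset Strict Implicit.
Unset Printing Implicit Defensive.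

Local Open Scope group_scope.

(** * Words and their reflections *)

Section Words.
Variables (W : finGroupType) (S : {set W}).
Local Notation I := (gens S).
Implicit Types (s t : I) (u v : seq I) (x y z r : W).

Definition alt_seq s t n : seq I := mkseq (fun k => if odd k then t else s) n.

Lemma alt_seqS s t n : alt_seq s t n.+1 = s :: alt_seq t s n.
Proof.
rewrite /alt_seq /mkseq /= -[1%N]addn0 iotaDl -map_comp; congr (_ :: _).
by apply: eq_map => k /=; case: (odd k).
Qed.

Lemma alt_seqSr s t n :
  alt_seq s t n.+1 = rcons (alt_seq s t n) (if odd n then t else s).
Proof. by rewrite /alt_seq mkseqS. Qed.

Lemma word_prod_nil : word_prod ([::] : seq I) = 1.
Proof. exact: big_nil. Qed.

Lemma word_prod_cons s u : word_prod (s :: u) = val s * word_prod u.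
Proof. exact: big_cons. Qed.

Lemma word_prod_cat u v : word_prod (u ++ v) = word_prod u * word_prod v.
Proof. exact: big_cat. Qed.

Lemma word_prod1 s : word_prod [:: s] = val s.
Proof. exact: big_seq1. Qed.

Lemma word_prod_rcons u s : word_prod (rcons u s) = word_prod u * val s.
Proof. by rewrite -cats1 word_prod_cat word_prod1. Qed.

Lemma alt_seqD s t n k :
  alt_seq s t (n + k) =
  alt_seq s t n ++ (if odd n then alt_seq t s k else alt_seq s t k).
Proof.
elim: n s t => // n IHn s t.
by rewrite addSn !alt_seqS IHn /=; case: (odd n).
Qed.

Lemma size_alt_seq s t n : size (alt_seq s t n) = n.
Proof. exact: size_mkseq. Qed.

Lemma rev_alt_seq s t n :
  rev (alt_seq s t n) = if odd n then alt_seq s t n else alt_seq t s n.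
Proof.
elim: n s t => // n IHn s t; rewrite alt_seqS rev_cons IHn /= if_neg.
by rewrite [alt_seq t s n.+1]alt_seqSr -alt_seqS alt_seqSr; case: (odd n).
Qed.

Lemma alt_seq_sub s t n : {subset alt_seq s t n <= [set s; t]}.
Proof. by move=> x /mapP[k _ ->]; rewrite !inE; case: ifP; rewrite eqxx ?orbT. Qed.

(* The reflections s_1 ... s_(i-1) s_i s_(i-1)^-1 ... s_1^-1. *)
Fixpoint refl_seq u : seq W :=
  if u is s :: u' then val s :: [seq r ^ (val s)^-1 | r <- refl_seq u'] else [::].

Lemma size_refl_seq u : size (refl_seq u) = size u.
Proof. by elim: u => //= s u IHu; rewrite size_map IHu. Qed.

Lemma refl_seq_cat u v :
  refl_seq (u ++ v) = refl_seq u ++ [seq r ^ (word_prod u)^-1 | r <- refl_seq v].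
Proof.
elim: u => [|s u IHu] /=.
  by rewrite word_prod_nil invg1 (eq_map (@conjg1 _)) map_id.
rewrite IHu map_cat -map_comp word_prod_cons; congr (_ :: _ ++ _).
by apply: eq_map => r /=; rewrite -conjgM invMg.
Qed.

(** The parity of the crossings of the hyperplane of [r] by the gallery of [u]. For a Coxeter system
    it depends only on [word_prod u], see [odd_refl_eq], so it can serve as a definition of
    inversions by words. *)
Definition odd_refl u r : bool := odd (count_mem r (refl_seq u)).

Lemma odd_refl_cat u v r :
  odd_refl (u ++ v) r = odd_refl u r (+) odd_refl v (r ^ word_prod u).
Proof.
rewrite /odd_refl refl_seq_cat count_cat oddD count_map; congr (_ (+) odd _).
by apply: eq_count => x /=; rewrite -(inj_eq (conjg_inj (word_prod u))) conjgKV.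
Qed.

Lemma refl_seq_in_reflections u : {subset refl_seq u <= reflections S}.
Proof.
elim: u => //= s u IHu r; rewrite inE => /orP[/eqP->|].
  by apply/imset2P; exists (val s) 1; rewrite ?inE ?conjg1 //; apply: (svalP s).
case/mapP=> x /IHu /imset2P[y g Sy _ ->] ->.
by rewrite -conjgM; apply: imset2_f; rewrite ?inE.
Qed.

(** Left multiplication by the inverse of the i-th reflection deletes the i-th letter: this is the
    exchange condition. *)
Lemma refl_seq_delete u r : r \in refl_seq u ->
  exists u', [/\ {subset u' <= u}, size u' < size u
    & word_prod u' = r^-1 * word_prod u].
Proof.
elim: u r => //= s u IHu r; rewrite inE => /orP[/eqP->|].
  exists u; split=> // [x|]; first by rewrite inE => ->; rewrite orbT.
  by rewrite word_prod_cons mulKg.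
case/mapP=> x /IHu [u' [sub lt_u' Pu']] ->.
exists (s :: u'); split=> // [y|].
  by rewrite !inE => /orP[->|/sub->]; rewrite ?orbT.
by rewrite !word_prod_cons Pu' -conjVg conjgE invgK -!mulgA mulKg.
Qed.


End Words.

Section Coxeter.
Variables (W : finGroupType) (S : {set W}).
Hypothesis coxS : coxeter_system S.
Local Notation I := (gens S).
Local Notation len := (cox_len S).
Local Notation inv := (inversions S).
Implicit Types (s t : I) (u v : seq I) (x y z r : W) (J : {set I}).

Lemma gen_order s : #[val s] = 2.
Proof. by case: coxS => _ ord2 _; apply: ord2; exact: (valP s). Qed.

Lemma gen_sq s : val s * val s = 1.
Proof. by rewrite -(expg_order (val s)) gen_order. Qed.

Lemma gen_inv s : (val s)^-1 = val s.
Proof. by rewrite -[LHS]mulg1 -(gen_sq s) mulKg. Qed.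

Lemma gen_neq1 s : val s != 1.
Proof. by rewrite -order_eq1 gen_order. Qed.

Lemma word_prod_rev u : word_prod (rev u) = (word_prod u)^-1.
Proof.
elim: u => [|s u IHu]; first by rewrite word_prod_nil invg1.
by rewrite rev_cons word_prod_rcons IHu word_prod_cons invMg gen_inv.
Qed.

Lemma refl_order r : r \in reflections S -> r * r = 1.
Proof.
case/imset2P=> y g Sy _ ->; rewrite -conjMg.
by rewrite (gen_sq (Sub y Sy)) conj1g.
Qed.

Lemma refl_inv r : r \in reflections S -> r^-1 = r.
Proof. by move=> Tr; rewrite -[LHS]mulg1 -(refl_order Tr) mulKg. Qed.

(** If the same reflection occurs at two positions, deleting both letters does not change the
    product. *)
Lemma word_prod_shorten u : ~~ uniq (refl_seq u) ->
  exists u', [/\ {subset u' <= u}, size u' < size u & word_prod u' = word_prod u].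
Proof.
elim: u => //= s u IHu.
case: (boolP (uniq (refl_seq u))) => [Uu|/IHu [u' [sub lt_u' eq_u']] _]; last first.
  exists (s :: u'); split=> // [y|]; last by rewrite !word_prod_cons eq_u'.
  by rewrite !inE => /orP[->|/sub->]; rewrite ?orbT.
rewrite (map_inj_uniq (conjg_inj _)) Uu andbT negbK => /mapP[x xu sx].
have {}sx : x = val s.
  by rewrite -(conjgKV (val s) x) -sx conjgE mulKg.
have [u' [sub lt_u' eq_u']] := refl_seq_delete xu.
exists u'; split=> [y /sub|/=|]; first by rewrite inE => ->; rewrite orbT.
  exact: ltnW.
by rewrite eq_u' word_prod_cons sx gen_inv.
Qed.

Lemma refl_seq_alt s t n :
  refl_seq (alt_seq s t n) = mkseq (fun k => (val s * val t) ^+ k * val s) n.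
Proof.
elim: n s t => // n IHn s t; rewrite alt_seqS /= {}IHn.
rewrite /mkseq /= mul1g -[1%N]addn0 iotaDl -!map_comp; congr (_ :: _).
apply: eq_map => k /=; rewrite conjgE invgK gen_inv expgS -!mulgA; congr (_ * _).
elim: k => [|k IHk]; first by rewrite !mul1g.
by rewrite !expgS -!mulgA IHk.
Qed.

Lemma sword_evalE (w : sword I) : sword_eval w = word_prod (unzip1 w).
Proof.
elim: w => [|[s b] w IHw]; rewrite /sword_eval ?big_nil ?word_prod_nil //=.
by rewrite big_cons word_prod_cons -IHw; case: b; rewrite /= ?gen_inv.
Qed.

Lemma unzip1_alt_word s t n : unzip1 (alt_word s t n) = alt_seq s t n.
Proof. by rewrite /unzip1 -map_comp. Qed.

Lemma word_prod_alt2 s t n : word_prod (alt_seq s t n.*2) = (val s * val t) ^+ n.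
Proof.
elim: n => [|n IHn]; first by rewrite word_prod_nil.
by rewrite doubleS !alt_seqS !word_prod_cons IHn mulgA expgS.
Qed.

Lemma pres_eq_odd_refl (w w' : sword I) : pres_eq (@coxeter_rel W S) w w' ->
  word_prod (unzip1 w) = word_prod (unzip1 w') /\
  odd_refl (unzip1 w) =1 odd_refl (unzip1 w').
Proof.
elim=> {w w'} [w //|w w' _ [-> eqr]|w w' w2 _ [-> eqr] _ [-> eqr']|||].
- by split.
- by split=> // r; rewrite eqr.
- move=> w w' w2 w2' _ [eqw eqr] _ [eqw2 eqr2].
  rewrite /unzip1 !map_cat -!/(unzip1 _) !word_prod_cat eqw eqw2.
  by split=> // r; rewrite !odd_refl_cat eqw eqr eqr2.
- move=> s b /=; rewrite !word_prod_cons word_prod_nil mulg1 gen_sq; split=> // r.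
  by rewrite /odd_refl /= conjgE mulgV mulg1 invgK addn0 addnn odd_double.
move=> _ _ [s t]; rewrite unzip1_alt_word word_prod_alt2 expg_order.
split=> [|r]; first by rewrite word_prod_nil.
(* The reflections of the relator are (st)^k s for k < 2m. As (st)^m = 1, the second half of the
   list repeats the first, so all parities are even. *)
rewrite /odd_refl refl_seq_alt -addnn /mkseq iotaD map_cat count_cat oddD.
rewrite add0n -{2}[cox_m s t]addn0 iotaDl -map_comp.
rewrite (_ : map _ _ =
    [seq (val s * val t) ^+ k * val s | k <- iota 0 (cox_m s t)]).
  by rewrite addbb.
by apply: eq_map => k /=; rewrite expgD expg_order mul1g.
Qed.

(** The presentation of W enters here: equal products give words that are equivalent under the
    Coxeter relations, and these preserve all parities. *)
Lemma odd_refl_eq u v : word_prod u = word_prod v -> odd_refl u =1 odd_refl v.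
Proof.
move=> eq_uv.
have unzipK (w : seq I) : unzip1 [seq (s, true) | s <- w] = w.
  by rewrite /unzip1 -map_comp map_id.
rewrite -(unzipK u) -(unzipK v); apply: (pres_eq_odd_refl _).2.
by case: coxS => _ _; apply; rewrite !sword_evalE !unzipK.
Qed.

(** * Length, inversions and parabolic subgroups *)

Definition parabolic J : {set W} := <<[set val s | s in J]>>.
Canonical parabolic_group J := Eval hnf in [group of parabolic J].

Lemma gen_parabolic J s : s \in J -> val s \in parabolic J.
Proof. by move=> Js; apply/mem_gen/imset_f. Qed.

Lemma word_prod_parabolic J u : {subset u <= J} -> word_prod u \in parabolic J.
Proof.
elim: u => [|s u IHu] sub; first by rewrite word_prod_nil group1.
rewrite word_prod_cons groupM ?gen_parabolic ?sub ?mem_head // IHu //.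
by move=> t ut; apply: sub; rewrite inE ut orbT.
Qed.

Lemma parabolic_word J x : x \in parabolic J ->
  exists2 u, {subset u <= J} & word_prod u = x.
Proof.
pose A := [set y | `[< exists2 u, {subset u <= J} & word_prod u = y >]].
have gA : group_set A.
  apply/group_setP; split=> [|y z]; rewrite ?inE.
    by apply/asboolP; exists [::]; rewrite ?word_prod_nil.
  move=> /asboolP[u sub_u <-] /asboolP[v sub_v <-]; apply/asboolP.
  exists (u ++ v); last exact: word_prod_cat.
  by move=> s; rewrite mem_cat => /orP[/sub_u|/sub_v].
have: parabolic J \subset Group gA.
  rewrite gen_subG; apply/subsetP=> _ /imsetP[s Js ->]; rewrite inE.
  by apply/asboolP; exists [:: s]; [move=> t /[1!inE] /eqP-> | exact: word_prod1].
by move=> /subsetP sub /sub; rewrite inE => /asboolP.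
Qed.

Lemma parabolicT x : x \in parabolic setT.
Proof.
case: coxS => gen_S _ _; have: x \in <<S>> by rewrite gen_S inE.
apply/subsetP/genS/subsetP=> s Ss; apply/imsetP.
by exists (Sub s Ss : I); rewrite ?inE.
Qed.

Lemma reduce_word u :
  exists v, [/\ {subset v <= u}, word_prod v = word_prod u & uniq (refl_seq v)].
Proof.
have [n] := ubnP (size u); elim: n u => // n IHn u lt_u_n.
have [Uu|/word_prod_shorten[u' [sub lt_u' <-]]] := boolP (uniq (refl_seq u)).
  by exists u; split.
have [v [sub_v <- Uv]] := IHn u' (leq_trans lt_u' lt_u_n).
by exists v; split=> // s /sub_v/sub.
Qed.

Lemma odd_refl_uniq u r : uniq (refl_seq u) -> odd_refl u r = (r \in refl_seq u).
Proof. by move=> Uu; rewrite /odd_refl count_uniq_mem //; case: (r \in _). Qed.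

Lemma odd_refl_mem u r : odd_refl u r -> r \in refl_seq u.
Proof. by rewrite /odd_refl -has_pred1 has_count; case: (count _ _). Qed.

(** Each reflection of [u] occurs exactly once, hence an odd number of times in [v], so [v] has at
    least as many letters. *)
Lemma uniq_refl_seq_shortest u v :
  uniq (refl_seq u) -> word_prod u = word_prod v -> size u <= size v.
Proof.
move=> Uu eq_uv; rewrite -size_refl_seq -(size_refl_seq v).
apply: uniq_leq_size => // r; rewrite -odd_refl_uniq // (odd_refl_eq eq_uv).
exact: odd_refl_mem.
Qed.

Lemma uniq_refl_seq_len u : uniq (refl_seq u) -> len (word_prod u) = size u.
Proof.
move=> Uu; rewrite /cox_len; set p := fun n => _.
have pu : p (size u) by apply/existsP; exists (in_tuple u).
(* The search in [cox_len] stops below #|W|. The reflections of [u] are distinct and differ from 1,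
   so the word is short enough to be found. *)
have lt_u : size u < #|W|.
  rewrite -(size_refl_seq u) [#|W|](cardD1 1) inE add1n ltnS cardE.
  apply: uniq_leq_size => // r /refl_seq_in_reflections/imset2P[s g Ss _ ->].
  rewrite mem_enum !inE andbT -(conj1g g) (inj_eq (conjg_inj g)).
  exact: (gen_neq1 (Sub s Ss)).
have has_p : has p (iota 0 #|W|).
  by apply/hasP; exists (size u); rewrite // mem_iota.
apply/eqP; rewrite eqn_leq; apply/andP; split.
  rewrite leqNgt; apply/negP=> lt_uf; have:= before_find 0 lt_uf.
  by rewrite nth_iota ?pu.
have:= nth_find 0 has_p; rewrite nth_iota -?has_find ?size_iota //; last first.
  by rewrite has_find size_iota in has_p.
case/existsP=> v /eqP Pv; rewrite add0n in v Pv.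
by rewrite -(size_tuple v) uniq_refl_seq_shortest.
Qed.

Lemma cox_len_le u : len (word_prod u) <= size u.
Proof.
have [v [_ eq_vu Uv]] := reduce_word u.
by rewrite -eq_vu uniq_refl_seq_len // uniq_refl_seq_shortest.
Qed.

Lemma parabolic_reduced_word J x : x \in parabolic J ->
  exists2 u, {subset u <= J} & reduced_word u x.
Proof.
case/parabolic_word=> u sub_u <-; have [v [sub_v eq_vu Uv]] := reduce_word u.
exists v => [s /sub_v/sub_u //|].
by rewrite /reduced_word eq_vu eqxx -eq_vu uniq_refl_seq_len /=.
Qed.

Lemma exists_reduced_word x : exists u, reduced_word u x.
Proof. by have [u _] := parabolic_reduced_word (parabolicT x); exists u. Qed.

Lemma reduced_word_uniq u x : reduced_word u x -> uniq (refl_seq u).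
Proof.
case/andP=> /eqP <- /eqP sz_u; apply: contraT.
case/word_prod_shorten=> v [_ lt_vu eq_v].
by rewrite sz_u -eq_v ltnNge cox_len_le in lt_vu.
Qed.

(** An odd parity allows a deletion that shortens the element. If a reflection r has even parity in
    u, it has odd parity in a word for r u, so r (r u) = u is shorter than r u. *)
Lemma inversions_odd u r : (r \in inv (word_prod u)) = odd_refl u r.
Proof.
have reducing v q : odd_refl v q -> len (q * word_prod v) < len (word_prod v).
  have [v' /andP[/eqP Pv' /eqP <-]] := exists_reduced_word (word_prod v).
  rewrite -(odd_refl_eq Pv') => /odd_refl_mem qv'.
  have := refl_seq_in_reflections qv' => /refl_inv qV.
  have [v2 [_ lt_v2 Pv2]] := refl_seq_delete qv'.
  by rewrite -Pv' -{1}qV -Pv2 (leq_ltn_trans (cox_len_le v2)).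
apply/setIdP/idP => [[Tr]|ur]; last first.
  split; last exact: reducing.
  exact: refl_seq_in_reflections (odd_refl_mem ur).
apply: contraLR => notMr; rewrite -leqNgt.
have [x [s [v [Pv def_r]]]] : exists x s v, word_prod v = x /\ r = val s ^ x^-1.
  case/imset2P: Tr => s g Ss _ ->; exists g^-1, (Sub s Ss : I).
  have [v /andP[/eqP Pv _]] := exists_reduced_word g^-1.
  by exists v; rewrite invgK.
(* A palindrome for r = x s x^-1. Its middle letter contributes r once; the parities from [v] and
   [rev v] cancel because [v ++ rev v] has product 1. *)
pose q := v ++ s :: rev v.
have Pq : word_prod q = r.
  by rewrite word_prod_cat word_prod_cons word_prod_rev def_r conjgE invgK Pv mulgA.
have rx : r ^ x = val s by rewrite def_r conjgKV.
have odd_q : odd_refl q r.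
  rewrite odd_refl_cat Pv rx -cat1s odd_refl_cat word_prod1 conjgE mulKg.
  have := odd_refl_cat v (rev v) r; rewrite Pv rx.
  rewrite (@odd_refl_eq _ [::]) => [|]; last first.
    by rewrite word_prod_cat word_prod_rev mulgV word_prod_nil.
  by rewrite addbCA => <-; rewrite /odd_refl /= eqxx.
have := reducing (q ++ u) r; rewrite odd_refl_cat odd_q Pq.
rewrite conjgE mulKg (negPf notMr) => /(_ isT).
by rewrite word_prod_cat Pq mulgA refl_order // mul1g => /ltnW.
Qed.

Lemma inversionsM x y r : (r \in inv (x * y)) = (r \in inv x) (+) (r ^ x \in inv y).
Proof.
have [u /andP[/eqP <- _]] := exists_reduced_word x.
have [v /andP[/eqP <- _]] := exists_reduced_word y.
by rewrite -word_prod_cat !inversions_odd odd_refl_cat.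
Qed.

Lemma inversions1 : inv 1 = set0.
Proof.
by apply/setP=> r; rewrite -(word_prod_nil S) inversions_odd in_set0.
Qed.

Lemma inversions_gen s : inv (val s) = [set val s].
Proof.
apply/setP=> r; rewrite in_set1 -{1}word_prod1 inversions_odd /odd_refl /=.
by rewrite addn0 eq_sym; case: (_ == _).
Qed.

Lemma inversions_reduced u x : reduced_word u x -> inv x =i refl_seq u.
Proof.
move=> red_u r; have /andP[/eqP <- _] := red_u.
by rewrite inversions_odd odd_refl_uniq // (reduced_word_uniq red_u).
Qed.

Lemma card_inversions x : #|inv x| = len x.
Proof.
have [u red_u] := exists_reduced_word x; have /andP[_ /eqP <-] := red_u.
rewrite -size_refl_seq -(card_uniqP (reduced_word_uniq red_u)).
exact/eq_card/inversions_reduced.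
Qed.

Lemma inversionsV x r : (r \in inv x^-1) = (r ^ x^-1 \in inv x).
Proof.
have := inversionsM x x^-1 (r ^ x^-1).
by rewrite mulgV inversions1 in_set0 conjgKV; do 2!case: (_ \in _).
Qed.

Lemma inversions_reflection x r : r \in inv x -> r \in reflections S.
Proof. by case/setIdP. Qed.

Lemma cox_lenV x : len x^-1 = len x.
Proof.
rewrite -!card_inversions -[RHS](cardJg _ x).
by apply: eq_card => r; rewrite inversionsV mem_conjg.
Qed.

Lemma cox_lenM_le x y : len (x * y) <= len x + len y.
Proof.
have [u /andP[/eqP <- /eqP <-]] := exists_reduced_word x.
have [v /andP[/eqP <- /eqP <-]] := exists_reduced_word y.
by rewrite -word_prod_cat -size_cat cox_len_le.
Qed.

(** Inv(xy) is the symmetric difference of A = Inv(x) and B = x Inv(y) x^-1, of sizes len x and len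
    y. Lengths add iff A and B are disjoint, iff A lies in the symmetric difference. *)
Lemma cox_lenM x y : (len (x * y) == len x + len y) = (inv x \subset inv (x * y)).
Proof.
set A := inv x; set B := inv y :^ x^-1.
have memB r : (r \in B) = (r ^ x \in inv y) by rewrite mem_conjgV.
have cardB : #|B| = len y by rewrite cardJg card_inversions.
have invE : inv (x * y) = (A :|: B) :\: (A :&: B).
  apply/setP=> r; rewrite inversionsM in_setD in_setU in_setI memB.
  by rewrite -/A; case: (r \in A); case: (_ \in _).
have cardE : len (x * y) + #|A :&: B| + #|A :&: B| = len x + len y.
  rewrite -cardB -!card_inversions -/A -(cardsUI A B) invE; congr (_ + _).
  rewrite -(cardsID (A :&: B) (A :|: B)) addnC; congr (_ + _).
  by rewrite (setIidPr (_ : A :&: B \subset A :|: B)) // subIset ?subsetUl.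
rewrite -cardE -addnA -{1}[len _]addn0 eqn_add2l invE.
rewrite eq_sym addn_eq0 andbb cards_eq0.
apply/eqP/subsetP => [AB0 r Ar|sub].
  by rewrite AB0 setD0 in_setU Ar.
apply/setP=> r; rewrite in_set0; apply/negP=> ABr.
have /setIP[/sub] := ABr; by rewrite in_setD ABr.
Qed.

Lemma weak_leE x y : weak_le S x y = (inv x \subset inv y).
Proof. by rewrite /weak_le -{1}(mulKVg x y) cox_lenM mulKVg. Qed.

Lemma cox_len1 : len 1 = 0.
Proof. by rewrite -card_inversions inversions1 cards0. Qed.

Lemma cox_len_gen s : len (val s) = 1%N.
Proof. by rewrite -card_inversions inversions_gen cards1. Qed.

Lemma cox_len_eq0 x : (len x == 0) = (x == 1).
Proof.
apply/eqP/eqP=> [lx0|->]; last exact: cox_len1.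
have [u /andP[/eqP Pu]] := exists_reduced_word x.
by rewrite lx0 => /nilP u0; rewrite -Pu u0 word_prod_nil.
Qed.

Lemma reflections_gen s : val s \in reflections S.
Proof.
by apply: (@inversions_reflection (val s)); rewrite inversions_gen set11.
Qed.

(** For r = s simple this explains the idiom [val s \in inv x^-1], used below to say that s is a
    right descent of x. *)
Lemma right_inversionE x r : r \in reflections S ->
  (r \in inv x^-1) = (len (x * r) < len x).
Proof. by move=> Tr; rewrite inE Tr cox_lenV -cox_lenV invMg invgK refl_inv. Qed.

Lemma inversions_mul_gen x s r :
  (r \in inv (x * val s)) = (r \in inv x) (+) (r == val s ^ x^-1).
Proof.
rewrite inversionsM inversions_gen in_set1; congr (_ (+) _).
by rewrite -(inj_eq (conjg_inj x) r) conjgKV.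
Qed.

Lemma cox_len_mul_gen x s :
  len (x * val s) = if val s \in inv x^-1 then (len x).-1 else (len x).+1.
Proof.
have up y : val s \notin inv y^-1 -> len (y * val s) = (len y).+1.
  move=> ns; rewrite -addn1 -(cox_len_gen s); apply/eqP; rewrite cox_lenM.
  apply/subsetP=> r yr; rewrite inversions_mul_gen yr /=.
  by apply: contraNneq ns => def_r; rewrite inversionsV -def_r.
case: ifPn => [|/up //]; rewrite inversionsV => xs.
suff /up: val s \notin inv (x * val s)^-1 by rewrite -mulgA gen_sq mulg1 => ->.
have ss : val s ^ (val s)^-1 = val s by rewrite conjgE mulgV mulg1 invgK.
by rewrite inversionsV inversions_mul_gen invMg conjgM ss xs eqxx.
Qed.

Lemma inversions_parabolic J x r : x \in parabolic J -> r \in inv x ->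
  r \in parabolic J.
Proof.
case/parabolic_reduced_word=> u sub_u /inversions_reduced ->.
elim: u sub_u r => //= s u IHu sub r.
have Js : s \in J by rewrite sub ?mem_head.
rewrite inE => /orP[/eqP->|/mapP[q uq ->]]; first exact: gen_parabolic.
rewrite groupJr ?groupV ?gen_parabolic // IHu // => q' uq'.
by rewrite sub // inE uq' orbT.
Qed.

Lemma parabolic_lenM J (v c : W) :
  (forall r, r \in inv v^-1 -> r \notin parabolic J) -> c \in parabolic J ->
  len (v * c) = len v + len c.
Proof.
move=> min_v Jc; apply/eqP; rewrite cox_lenM; apply/subsetP=> r vr.
rewrite inversionsM vr /=; apply/negP=> /(inversions_parabolic Jc).
by apply/negP/min_v; rewrite inversionsV conjgK.
Qed.

(** Take v of least length in x W_J. A right inversion r of v in W_J would give the shorter element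
    v r of the same coset, so [parabolic_lenM] applies. *)
Lemma parabolic_coset_min J x : exists v : W,
  v^-1 * x \in parabolic J /\
  (forall c, c \in parabolic J -> len (v * c) = len v + len c).
Proof.
have Jx : x^-1 * x \in parabolic J by rewrite mulVg group1.
case: (arg_minnP (P := fun v : W => v^-1 * x \in parabolic J) len Jx) => v Jv min_v.
exists v; split=> // c; apply: parabolic_lenM => r vr; apply/negP=> Jr.
have := inversions_reflection vr => Tr.
move: vr; rewrite right_inversionE // ltnNge min_v //.
by rewrite invMg -mulgA groupM ?groupV.
Qed.

(** * Rank two parabolic subgroups *)

Lemma cox_mC s t : cox_m t s = cox_m s t.
Proof. by rewrite /cox_m -orderV invMg !gen_inv. Qed.

Lemma uniq_alt_seq s t n : uniq (refl_seq (alt_seq s t n)) = (n <= cox_m s t).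
Proof.
rewrite refl_seq_alt; apply/mkseq_uniqP/idP=> [inj_f|le_nm i j lt_in lt_jn].
  rewrite leqNgt; apply/negP=> lt_mn.
  have := inj_f 0 (cox_m s t); rewrite !inE lt_mn (leq_ltn_trans _ lt_mn) //.
  rewrite expg_order => /(_ isT isT erefl)/eqP.
  by rewrite eq_sym -leqn0 leqNgt order_gt0.
move/mulIg/eqP; rewrite eq_expg_mod_order -/(cox_m s t).
rewrite !modn_small; first by move/eqP.
all: exact: leq_trans le_nm.
Qed.

(** Cut the relator (st)^m = 1 into two alternating words of length m; the inverse of one is its
    reversal, again an alternating word. *)
Lemma word_prod_alt_seqC s t :
  word_prod (alt_seq s t (cox_m s t)) = word_prod (alt_seq t s (cox_m s t)).
Proof.
have := word_prod_alt2 s t (cox_m s t).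
rewrite expg_order -addnn alt_seqD word_prod_cat => /eqP.
rewrite -eq_invg_mul -word_prod_rev rev_alt_seq.
by case: (odd _) => /eqP.
Qed.

Lemma cox_len_alt_seq s t n : n <= cox_m s t -> len (word_prod (alt_seq s t n)) = n.
Proof. by rewrite -uniq_alt_seq => /uniq_refl_seq_len ->; exact: size_alt_seq. Qed.

(** Two equal adjacent letters would produce the same reflection twice, so the letters alternate. *)
Lemma alt_seq_rank2 s t u : {subset u <= [set s; t]} -> uniq (refl_seq u) ->
  u = alt_seq s t (size u) \/ u = alt_seq t s (size u).
Proof.
elim: u => [|a u IHu] sub /=; first by left.
rewrite (map_inj_uniq (conjg_inj _)) => /andP[not_a Uu].
have {}IHu : u = alt_seq s t (size u) \/ u = alt_seq t s (size u).
  by apply: IHu Uu => b ub; rewrite sub // inE ub orbT.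
have := sub a (mem_head a u); rewrite !inE !alt_seqS.
case: u Uu not_a IHu {sub} => [|b u] Uu not_a IHu.
  by case/orP=> /eqP ->; [left | right].
have neq_ab : a != b.
  apply: contraNneq not_a => ->; rewrite /= conjgE mulgV mulg1 invgK.
  exact: mem_head.
have hd p q : b :: u = alt_seq p q (size (b :: u)) -> b = p.
  by rewrite /= alt_seqS; case.
case: IHu => /[dup] /hd eq_b <-; rewrite -eq_b in neq_ab *.
  by rewrite (negPf neq_ab) => /eqP ->; right.
by rewrite (negPf neq_ab) orbF => /eqP ->; left.
Qed.

Lemma rank2_len s t x : x \in parabolic [set s; t] -> len x <= cox_m s t.
Proof.
case/parabolic_reduced_word=> u sub_u /[dup] /reduced_word_uniq Uu.
case/andP=> _ /eqP <-; case: (alt_seq_rank2 sub_u Uu) (Uu) => ->.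
  by rewrite uniq_alt_seq size_alt_seq.
by rewrite uniq_alt_seq size_alt_seq cox_mC.
Qed.

(** If t = (st)^k s with k < n, then (st)^(k+1) = 1, so m divides k + 1. *)
Lemma alt_seq_full s t n :
  s != t -> val t \in refl_seq (alt_seq s t n) -> cox_m s t <= n.
Proof.
move=> neq_st; rewrite refl_seq_alt => /mapP[k]; rewrite mem_iota /= => lt_kn.
move=> def_t; apply: leq_trans lt_kn; apply: dvdn_leq => //.
by rewrite order_dvdn expgSr mulgA -def_t gen_sq.
Qed.

(** Write y = v b with v minimal in its coset of the subgroup generated by s and t. Both s and t are
    descents of b, so an alternating reduced word of b^-1 has both among its reflections, which by
    [alt_seq_full] forces length m. *)
Lemma polygon s t y : s != t -> val s \in inv y^-1 -> val t \in inv y^-1 ->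
  exists v : W, y = v * word_prod (alt_seq s t (cox_m s t)) /\
   (forall c, c \in parabolic [set s; t] -> len (v * c) = len v + len c).
Proof.
move=> neq_st ys yt; have [v [Jb lenv]] := parabolic_coset_min [set s; t] y.
move: Jb (mulKVg v y); move: (v^-1 * y) => b Jb def_y.
exists v; split=> //; rewrite -def_y; congr (_ * _).
have desc p : p \in [set s; t] -> val p \in inv y^-1 -> val p \in inv b^-1.
  move=> Jp; rewrite !right_inversionE ?reflections_gen // -def_y -mulgA.
  by rewrite !lenv ?groupM ?gen_parabolic // ltn_add2l.
have {ys}bs := desc s (set21 s t) ys; have {yt}bt := desc t (set22 s t) yt.
have [u sub_u red_u] := parabolic_reduced_word (groupVr Jb).
have [/eqP Pu _] := andP red_u; have Uu := reduced_word_uniq red_u.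
move: bs bt; rewrite !(inversions_reduced red_u) -[b]invgK -Pu.
rewrite -word_prod_rev.
case: (alt_seq_rank2 sub_u Uu) (Uu) => ->; rewrite uniq_alt_seq => le_m.
  move=> _ /(alt_seq_full neq_st) ge_m.
  rewrite (_ : size u = cox_m s t); last by apply/eqP; rewrite eqn_leq le_m ge_m.
  by rewrite rev_alt_seq; case: odd; rewrite // word_prod_alt_seqC.
rewrite eq_sym in neq_st; move=> /(alt_seq_full neq_st) ge_m _.
rewrite (_ : size u = cox_m s t); last first.
  by apply/eqP; rewrite -cox_mC eqn_leq le_m ge_m.
by rewrite rev_alt_seq; case: odd; rewrite // word_prod_alt_seqC.
Qed.

(** * Descents and intervals in the weak order *)

Lemma inversions_inj : injective inv.
Proof.
move=> x y eq_xy; have: weak_le S x y by rewrite weak_leE eq_xy.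
rewrite /weak_le -!card_inversions eq_xy -{1}[#|inv y|]addn0 eqn_add2l eq_sym.
rewrite card_inversions cox_len_eq0 => /eqP xy1.
by rewrite -(mulKVg x y) xy1 mulg1.
Qed.

Lemma inversions_down x s r : val s \in inv x^-1 ->
  (r \in inv (x * val s)) = (r \in inv x) && (r != val s ^ x^-1).
Proof.
rewrite inversionsV inversions_mul_gen => xs.
by case: eqP => [->|_]; rewrite ?xs ?addbF ?andbT.
Qed.

Lemma exists_descent x : x != 1 -> exists s, val s \in inv x^-1.
Proof.
have [u] := exists_reduced_word x; case/lastP: u => [|u s] /andP[/eqP <- /eqP sz].
  by rewrite word_prod_nil eqxx.
move=> _; exists s; rewrite right_inversionE ?reflections_gen // -sz size_rcons.
by rewrite word_prod_rcons -mulgA gen_sq mulg1 ltnS cox_len_le.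
Qed.

(** Take s to be a descent of x^-1 y. The reflection y s y^-1 is then an inversion of y but not of
    x, and it is the only inversion lost in passing from y to y s. *)
Lemma weak_lt_descent x y : inv x \subset inv y -> x != y ->
  exists s, val s \in inv y^-1 /\ inv x \subset inv (y * val s).
Proof.
move=> le_xy neq_xy; have [|s] := @exists_descent (x^-1 * y).
  by apply: contraNneq neq_xy => xy1; rewrite -(mulKVg x y) xy1 mulg1.
rewrite inversionsV invMg invgK conjgM => xys.
have := inversionsM x (x^-1 * y) (val s ^ y^-1); rewrite mulKVg xys addbT => ysE.
have not_x : val s ^ y^-1 \notin inv x.
  by apply/negP=> xs; have := subsetP le_xy _ xs; rewrite ysE xs.
exists s; split; first by rewrite inversionsV ysE.
apply/subsetP=> r xr; rewrite inversions_down; last by rewrite inversionsV ysE.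
by rewrite (subsetP le_xy) //=; apply: contraNneq not_x => <-.
Qed.

Lemma reflection_inversion r : r \in reflections S -> r \in inv r.
Proof.
move=> Tr; rewrite inE Tr refl_order // cox_len1 lt0n cox_len_eq0.
case/imset2P: Tr => s g Ss _ ->; rewrite -(conj1g g) (inj_eq (conjg_inj g)).
exact: (gen_neq1 (Sub s Ss)).
Qed.

Lemma inversions_mul_refl x r : r \in reflections S ->
  (r \in inv (x * r)^-1) = (r \notin inv x^-1).
Proof.
move=> Tr; rewrite invMg inversionsM (refl_inv Tr) reflection_inversion //.
by rewrite conjgE mulKg.
Qed.

(* In the rank two coset of [a], the bottom element [b] lies in both lower covers;
   if [r] is not an inversion of [b], then [r ^ a] is a reflection of the rank two
   parabolic subgroup which is conjugate to the simple reflection [s] by the minimal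
   coset representative [a^-1 * y], so it has length one and [r] is the label of one
   of the two covers. *)
Lemma weak_diamond y s a (p q : I) :
  val s \in inv y^-1 -> inv a \subset inv y ->
  p != q -> val p \in inv a^-1 -> val q \in inv a^-1 ->
  val s ^ y^-1 \in inv (a * val p) -> val s ^ y^-1 \in inv (a * val q) ->
  exists b : W, [/\ inv b \subset inv (a * val p), inv b \subset inv (a * val q)
    & val s ^ y^-1 \in inv b].
Proof.
move=> ys le_ay neq_pq ap aq; set r := _ ^ _ => apr aqr.
have [b [def_a lenb]] := polygon neq_pq ap aq.
set K := [set p; q] in lenb; set d := word_prod _ in def_a.
have Kd : d \in parabolic K by apply: word_prod_parabolic; exact: alt_seq_sub.
have le_b c : c \in parabolic K -> inv b \subset inv (b * c).
  by move=> Kc; rewrite -cox_lenM lenb.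
have [Kp Kq] : val p \in parabolic K /\ val q \in parabolic K.
  by rewrite !gen_parabolic ?set21 ?set22.
exists b; split; rewrite ?def_a -?mulgA ?le_b ?groupM //.
apply: contraTT apr => not_br; apply/negP=> apr.
have [ar neq_rp] : r \in inv a /\ r != val p ^ a^-1.
  by apply/andP; rewrite -inversions_down.
have neq_rq : r != val q ^ a^-1 by move: aqr; rewrite inversions_down // => /andP[].
set c := r ^ a; have Kc : c \in parabolic K.
  rewrite /c def_a conjgM groupJ //; apply: (@inversions_parabolic K d) => //.
  by move: ar; rewrite def_a inversionsM (negPf not_br).
pose z := a^-1 * y.
(* As a <= y, an inversion g of z is not a right inversion of a, so a g is longer than a. For g in
   the parabolic subgroup this is impossible, since a = b d with d of the greatest length there. *)
have Kz g : g \in inv z -> g \notin parabolic K.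
  move=> zg; apply/negP=> Kg; have Tg := inversions_reflection zg.
  have not_ag : g \notin inv a^-1.
    rewrite inversionsV; apply/negP=> ag; have := subsetP le_ay _ ag.
    by rewrite -(mulKVg a y) inversionsM ag conjgKV zg.
  have := inversions_mul_refl a Tg; rewrite not_ag right_inversionE //.
  rewrite -mulgA refl_order // mulg1 ltnNge => /negP[].
  rewrite def_a -mulgA !lenb ?groupM // leq_add2l {2}/d cox_len_alt_seq //.
  by rewrite rank2_len ?groupM.
have cz : c * z = z * val s.
  by rewrite /c /r /z -!conjgM conjgE invMg !invgK !mulgA mulgK mulgKV.
have: len (c * z) <= len z + 1.
  by rewrite cz (leq_trans (cox_lenM_le _ _)) // cox_len_gen.
rewrite -cox_lenV invMg (@parabolic_lenM K) ?groupV //; last by rewrite invgK.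
rewrite !cox_lenV leq_add2l.
have [u sub_u /andP[/eqP Pu /eqP <-]] := parabolic_reduced_word Kc.
have c1 : c != 1.
  rewrite -(conj1g a) (inj_eq (conjg_inj a)) -(conj1g y^-1) (inj_eq (conjg_inj _)).
  exact: gen_neq1.
case: u Pu sub_u => [|p' [|//]] Pu sub_u.
  by rewrite -Pu word_prod_nil eqxx in c1.
have rE : r = val p' ^ a^-1 by rewrite -word_prod1 Pu conjgK.
have := sub_u p' (mem_head _ _); rewrite !inE => /orP[]/eqP def_p'.
  by rewrite rE def_p' eqxx in neq_rp.
by rewrite rE def_p' eqxx in neq_rq.
Qed.

(** * Uniqueness of shard labels *)

(** When r is the reflection of a cover x < y, these are the z whose join with x is y; see
    [weak_joinE]. *)
Definition below_with y r : {set W} :=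
  [set z | (inv z \subset inv y) && (r \in inv z)].

Definition minimal_below y r j :=
  j \in below_with y r /\
  forall z, z \in below_with y r -> inv z \subset inv j -> z = j.

Lemma exists_minimal_below y r a : a \in below_with y r ->
  exists2 j, minimal_below y r j & inv j \subset inv a.
Proof.
move=> ya; pose P z := (z \in below_with y r) && (inv z \subset inv a).
have Pa : P a by rewrite /P ya subxx.
case: (arg_minnP len Pa) => j /andP[yj le_ja] min_j; exists j => //.
split=> // z yz le_zj; apply/inversions_inj/eqP; rewrite eqEcard le_zj.
by rewrite !card_inversions min_j // /P yz (subset_trans le_zj).
Qed.

(* Newman's lemma, with [weak_diamond] as local confluence. *)
Lemma minimal_below_unique y s j j' : val s \in inv y^-1 ->
  minimal_below y (val s ^ y^-1) j -> minimal_below y (val s ^ y^-1) j' -> j = j'.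
Proof.
move=> ys; set r := val s ^ y^-1 => min_j min_j'.
(* The induction is on the length of a common upper bound a of the two minimal elements; it starts
   from a = y. *)
suff below_elt n a k k' :
    minimal_below y r k -> minimal_below y r k' -> len a < n ->
    [/\ inv a \subset inv y, inv k \subset inv a & inv k' \subset inv a] -> k = k'.
  apply: (below_elt _ y) (ltnSn _) _ => //.
  by case: min_j min_j' => /setIdP[? _] _ [/setIdP[? _] _].
elim: n a k k' {j j' min_j min_j'} => // n IHn a j j' min_j min_j' lt_an.
case=> le_ay le_ja le_j'a.
have [[yj uj] [yj' uj']] := (min_j, min_j').
have [eq_ja|neq_ja] := eqVneq j a; first by apply/esym/uj; rewrite // eq_ja.
have [eq_ja'|neq_ja'] := eqVneq j' a; first by apply: uj'; rewrite // eq_ja'.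
have [p [ap le_jp]] := weak_lt_descent le_ja neq_ja.
have [q [aq le_jq]] := weak_lt_descent le_j'a neq_ja'.
have lt_a (p' : I) : val p' \in inv a^-1 -> len (a * val p') < n.
  by rewrite right_inversionE ?reflections_gen // => /leq_trans; apply.
have le_a (p' : I) : val p' \in inv a^-1 -> inv (a * val p') \subset inv y.
  move=> ap'; apply: subset_trans le_ay; apply/subsetP=> g.
  by rewrite inversions_down // => /andP[].
have [eq_pq|neq_pq] := eqVneq p q.
  rewrite -eq_pq in le_jq.
  by apply: IHn min_j min_j' (lt_a p ap) _; split; rewrite ?le_a.
have [rj rj'] : r \in inv j /\ r \in inv j' by case/setIdP: yj yj' => _ ? /setIdP[].
have [||b [le_bp le_bq br]] := weak_diamond ys le_ay neq_pq ap aq.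
- exact: subsetP rj.
- exact: subsetP rj'.
(* A minimal element k below b is compared with j under a p and with j' under a q, both shorter than
   a. *)
have [|k min_k le_kb] := @exists_minimal_below y r b.
  by rewrite inE br (subset_trans le_bp) ?le_a.
rewrite (IHn _ _ _ min_j min_k (lt_a p ap)); last first.
  by split; rewrite ?le_a // (subset_trans le_kb).
apply: (IHn _ _ _ min_k min_j' (lt_a q aq)).
by split; rewrite ?le_a // (subset_trans le_kb).
Qed.

(** * Matsumoto's theorem and shard loops *)

Definition word_lift u : braid_group S := \prod_(s <- u) braid_gen s.

Lemma word_lift_cat u v : word_lift (u ++ v) = word_lift u * word_lift v.
Proof. exact: big_cat. Qed.

Lemma word_lift_rcons u s : word_lift (rcons u s) = word_lift u * braid_gen s.
Proof. by rewrite -cats1 word_lift_cat /word_lift big_seq1. Qed.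

Lemma word_liftE u : word_lift u = pres_class _ [seq (s, true) | s <- u].
Proof.
elim: u => [|s u IHu]; rewrite /word_lift ?big_nil // big_cons -/(word_lift u).
by rewrite IHu -pres_classM.
Qed.

Lemma word_lift_alt s t : s != t ->
  word_lift (alt_seq s t (cox_m s t)) = word_lift (alt_seq t s (cox_m s t)).
Proof.
move=> neq_st; rewrite !word_liftE; apply/pres_classE.
rewrite -!map_comp; apply: pres_rel; exact: BraidRel.
Qed.

(** The parity of n decides which alternating word ends in s; the existential hides this case
    distinction from later proofs. *)
Lemma alt_seq_last s t n : exists p q,
  ((p, q) = (s, t) \/ (p, q) = (t, s)) /\
  alt_seq p q n.+1 = rcons (alt_seq p q n) s.
Proof.
exists (if odd n then t else s), (if odd n then s else t).
by rewrite alt_seqSr; case: (odd n); auto.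
Qed.

(** Induction on length, comparing last letters. If they are s and t with s != t, then x = a d with
    d the longest element of the rank two subgroup, and both words are linked to a word of a
    followed by an alternating word of d. *)
Lemma matsumoto u v x :
  reduced_word u x -> reduced_word v x -> word_lift u = word_lift v.
Proof.
have [n] := ubnP (len x); elim: n x u v => // n IHn x u v lt_xn red_u red_v.
have [sz_u sz_v] : size u = len x /\ size v = len x.
  by case/andP: red_u => _ /eqP; case/andP: red_v => _ /eqP.
case/lastP: u v => [|u s] v in red_u red_v sz_u sz_v *.
  by move: sz_v; rewrite -sz_u => /size0nil ->.
case/lastP: v red_v sz_v => [|v t] red_v sz_v.
  by move: sz_u; rewrite -sz_v => /size0nil ->.
have descent (w : seq I) (p : I) : reduced_word (rcons w p) x ->
    reduced_word w (x * val p) /\ val p \in inv x^-1.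
  rewrite /reduced_word word_prod_rcons size_rcons => /andP[/eqP Px /eqP sz].
  have Pw : word_prod w = x * val p by rewrite -Px -mulgA gen_sq mulg1.
  have xp : val p \in inv x^-1.
    by rewrite right_inversionE ?reflections_gen // -sz ltnS -Pw cox_len_le.
  by rewrite Pw cox_len_mul_gen xp -sz /= !eqxx.
have [[ru xs] [rv xt]] := (descent u s red_u, descent v t red_v).
have lt_desc (p : I) : val p \in inv x^-1 -> len (x * val p) < n.
  by rewrite right_inversionE ?reflections_gen // => /leq_trans; apply.
have [eq_st|neq_st] := eqVneq s t.
  rewrite -eq_st !word_lift_rcons; congr (_ * _); rewrite -eq_st in rv.
  exact: IHn (lt_desc s xs) ru rv.
have [a [def_x lena]] := polygon neq_st xs xt.
have [w /andP[/eqP Pw /eqP szw]] := exists_reduced_word a.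
have len_x : len x = (len a + cox_m s t)%N.
  rewrite def_x lena ?cox_len_alt_seq //.
  by apply: word_prod_parabolic; exact: alt_seq_sub.
(* Choose the alternating word that ends in p, apply induction to the prefixes, and use the braid
   relation to return to the fixed alternating word. *)
have last_swap u' (p p' : I) : (p, p') = (s, t) \/ (p, p') = (t, s) ->
    reduced_word u' (x * val p) -> val p \in inv x^-1 ->
    word_lift (rcons u' p) = word_lift w * word_lift (alt_seq s t (cox_m s t)).
  move=> pp' ru' xp; have [p1 [q1 [pq alt_p]]] := alt_seq_last p p' (cox_m s t).-1.
  have pq1 : (p1, q1) = (s, t) \/ (p1, q1) = (t, s).
    by case: pp' pq => -[-> ->] [] ->; auto.
  rewrite prednK ?order_gt0 // in alt_p.
  have [liftC prodC] :
      word_lift (alt_seq s t (cox_m s t)) = word_lift (alt_seq p1 q1 (cox_m s t)) /\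
      word_prod (alt_seq s t (cox_m s t)) = word_prod (alt_seq p1 q1 (cox_m s t)).
    by case: pq1 => -[-> ->]; rewrite // word_lift_alt // word_prod_alt_seqC.
  rewrite liftC alt_p !word_lift_rcons mulgA -word_lift_cat; congr (_ * _).
  apply: IHn (lt_desc p xp) ru' _; rewrite /reduced_word word_prod_cat Pw.
  rewrite cox_len_mul_gen xp len_x size_cat szw size_alt_seq.
  rewrite def_x prodC alt_p word_prod_rcons -!mulgA gen_sq mulg1 eqxx /=.
  by rewrite -{2}(@prednK (cox_m s t)) ?order_gt0 // addnS.
by rewrite (last_swap u s t) ?(last_swap v t s); auto.
Qed.

Lemma braid_liftE u x : reduced_word u x -> braid_lift S x = word_lift u.
Proof.
move=> red_u; rewrite /braid_lift /some_reduced_word.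
case: pickP => [v red_v|no_word]; first exact: matsumoto red_v red_u.
have /andP[_ /eqP sz_u] := red_u.
by have := no_word (Tuple (introT eqP sz_u)); rewrite red_u.
Qed.

Lemma braid_liftM x y : len (x * y) = len x + len y ->
  braid_lift S (x * y) = braid_lift S x * braid_lift S y.
Proof.
have [u red_u] := exists_reduced_word x; have [v red_v] := exists_reduced_word y.
move=> lenM; rewrite (braid_liftE red_u) (braid_liftE red_v) -word_lift_cat.
apply: braid_liftE; move: red_u red_v.
rewrite /reduced_word lenM word_prod_cat size_cat.
by move=> /andP[/eqP -> /eqP ->] /andP[/eqP -> /eqP ->]; rewrite !eqxx.
Qed.

Lemma braid_lift1 : braid_lift S 1 = 1.
Proof.
rewrite (@braid_liftE [::]); first by rewrite /word_lift big_nil.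
by rewrite /reduced_word word_prod_nil cox_len1 eqxx.
Qed.

(** In the interval from a to y the top edge is opposite to the bottom edge from a to a q. With y =
    a c s = a q c and lengths adding, the factor B(c) cancels in B(y) B(ys)^-1 and leaves B(aq)
    B(a)^-1. *)
Lemma opposite_edge y s t : s != t -> val s \in inv y^-1 -> val t \in inv y^-1 ->
  exists a : W, exists q : I, [/\ len (a * val q) < len y,
    val q \in inv (a * val q)^-1, val q ^ (a * val q)^-1 = val s ^ y^-1,
    inv (a * val q) \subset inv y &
    braid_lift S y * (braid_lift S (y * val s))^-1 =
    braid_lift S (a * val q) * (braid_lift S a)^-1].
Proof.
move=> neq_st ys yt; have [a [def_y lena]] := polygon neq_st ys yt.
have m_gt1 : 1 < cox_m s t.
  rewrite ltn_neqAle order_gt0 eq_sym order_eq1 -eq_invg_mul gen_inv andbT.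
  by rewrite (inj_eq val_inj).
(* The letters are ordered so that the alternating word of length m starting with p ends in s; c is
   that word without its last letter. *)
have [p [q [pq alt_p]]] := alt_seq_last s t (cox_m s t).-1.
rewrite prednK ?order_gt0 // in alt_p.
set c := word_prod (alt_seq p q (cox_m s t).-1).
have mE : cox_m p q = cox_m s t by case: pq => -[-> ->]; rewrite // cox_mC.
have JE : [set p; q] = [set s; t] by case: pq => -[-> ->]; rewrite // setUC.
have Jc : c \in parabolic [set s; t].
  by rewrite -JE; apply: word_prod_parabolic; exact: alt_seq_sub.
have Jq : val q \in parabolic [set s; t] by rewrite -JE gen_parabolic ?set22.
have Js : val s \in parabolic [set s; t] by rewrite gen_parabolic ?set21.
(* [c] carries the edge at the bottom of the rank two interval to the opposite one. *)
have qc_cs : val q * c = c * val s.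
  rewrite -word_prod_rcons -alt_p -mE word_prod_alt_seqC.
  rewrite -[in RHS](@prednK (cox_m p q)) ?order_gt0 //.
  by rewrite alt_seqS word_prod_cons mE.
have {}def_y : y = a * (c * val s).
  rewrite def_y; congr (_ * _); rewrite -word_prod_rcons -alt_p.
  by case: pq => -[-> ->]; rewrite // word_prod_alt_seqC.
have len_c : len c = (cox_m s t).-1 by rewrite cox_len_alt_seq // mE leq_pred.
have len_cs : len (c * val s) = (len c).+1.
  rewrite -word_prod_rcons -alt_p cox_len_alt_seq ?mE // len_c prednK //.
  exact: ltnW.
have len_aq : len (a * val q) = (len a).+1 by rewrite lena // cox_len_gen addn1.
exists a, q; split.
- by rewrite len_aq def_y lena ?groupM // len_cs addnS ltnS len_c -ltnS;
     rewrite -[X in X < _]addn0 ltn_add2l -subn1 subn_gt0.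
- by rewrite right_inversionE ?reflections_gen // -mulgA gen_sq mulg1 len_aq.
- have fixed (p1 : I) : val p1 ^ (val p1)^-1 = val p1.
    by rewrite conjgE mulgV mulg1 invgK.
  rewrite def_y !invMg !conjgM !fixed; congr (_ ^ _).
  by rewrite [RHS]conjgE invgK mulgA -qc_cs mulgK.
- rewrite def_y -qc_cs mulgA -cox_lenM -mulgA qc_cs.
  rewrite (lena (c * val s)) ?groupM // len_cs.
  by rewrite len_aq addnS.
rewrite def_y -!mulgA gen_sq mulg1 -qc_cs braid_liftM ?lena ?groupM //.
rewrite [braid_lift _ (val q * c)]braid_liftM; last first.
  by rewrite qc_cs len_cs cox_len_gen.
by rewrite braid_liftM ?lena // braid_liftM ?lena // invMg !mulgA mulgK.
Qed.

Lemma minimal_below_lift y s : val s \in inv y^-1 ->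
  exists2 j, minimal_below y (val s ^ y^-1) j &
    braid_lift S y * (braid_lift S (y * val s))^-1 =
    braid_lift S j * (braid_lift S (val s ^ y^-1 * j))^-1.
Proof.
have [n] := ubnP (len y); elim: n y s => // n IHn y s lt_yn ys.
have [/existsP[t /andP[neq_st yt]]|/existsPn only_s] :=
    boolP [exists t : I, (s != t) && (val t \in inv y^-1)].
  have [a [q [lt_y q_desc eq_r le_y ->]]] := opposite_edge neq_st ys yt.
  have [j [yj uj] Bj] := IHn _ _ (leq_trans lt_y lt_yn) q_desc.
  rewrite eq_r in yj uj Bj.
  have le_jq : inv j \subset inv (a * val q) by case/setIdP: yj.
  exists j; last by rewrite -Bj -mulgA gen_sq mulg1.
  split=> [|z /setIdP[_ rz] le_zj].
    by case/setIdP: yj => le_j rj; rewrite inE rj (subset_trans le_j).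
  by apply: uj; rewrite // inE rz (subset_trans le_zj).
exists y; last by rewrite [val s ^ _]conjgE invgK -!mulgA mulVg mulg1.
split=> [|z /setIdP[le_zy rz] _].
  by rewrite inE subxx -inversionsV.
apply/eqP; apply: contraT => neq_zy.
have [t [yt le_zt]] := weak_lt_descent le_zy neq_zy.
have := only_s t; rewrite yt andbT negbK => /eqP def_t; rewrite -def_t in le_zt.
by have := subsetP le_zt _ rz; rewrite inversions_down // eqxx andbF.
Qed.

(** * Covers and shard labels *)

Lemma weak_ltE x y : weak_lt S x y = (x != y) && (inv x \subset inv y).
Proof. by rewrite /weak_lt weak_leE. Qed.

Lemma weak_coverP x y : reflect (exists2 s : I, val s \in inv y^-1 & x = y * val s)
  (weak_cover S x y).
Proof.
apply: (iffP andP) => [[]|[s ys ->]].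
  rewrite weak_ltE => /andP[neq_xy le_xy] /forallP no_mid.
  have [s [ys le_xs]] := weak_lt_descent le_xy neq_xy; exists s => //.
  have lt_len : len (y * val s) < len y.
    by rewrite -right_inversionE ?reflections_gen.
  have := no_mid (y * val s); rewrite !weak_ltE le_xs andbT.
  apply: contraNeq => -> /=; apply/andP; split.
    by apply: contraTneq lt_len => ->; rewrite ltnn.
  by apply/subsetP=> r; rewrite inversions_down // => /andP[].
have lt_len : len (y * val s) < len y.
    by rewrite -right_inversionE ?reflections_gen.
have len_y : len y = (len (y * val s)).+1.
  by move: lt_len; rewrite cox_len_mul_gen ys; case: (len y).
split.
  rewrite weak_ltE; apply/andP; split.
    by apply: contraTneq lt_len => ->; rewrite ltnn.
  by apply/subsetP=> r; rewrite inversions_down // => /andP[].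
apply/forallP=> z; rewrite !weak_ltE; apply/negP.
case/andP=> /andP[neq1 le1] /andP[neq2 le2].
have lt_card a b : a != b -> inv a \subset inv b -> len a < len b.
  move=> neq_ab le_ab; rewrite -!card_inversions; apply: proper_card.
  by rewrite properEneq le_ab (inj_eq inversions_inj) neq_ab.
have := leq_ltn_trans (lt_card _ _ neq1 le1) (lt_card _ _ neq2 le2).
by rewrite len_y ltnn.
Qed.

Lemma the_elt_set1 x : the_elt [set x] = x.
Proof.
rewrite /the_elt /unset1 cards1 eqxx /=.
case: pickP => [z /[1!inE] /eqP // |/(_ x)].
by rewrite inE eqxx.
Qed.

(** A lower cover of j with a reflection other than r would still have r as an inversion, against
    minimality. So r j is the only lower cover and j is join-irreducible. *)
Lemma minimal_below_lower y r j : minimal_below y r j -> lower_cover S j = r * j.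
Proof.
case=> /setIdP[le_jy rj] min_j; have Tr := inversions_reflection rj.
have j_neq1 : j != 1 by apply: contraTneq rj => ->; rewrite inversions1 inE.
have coverE x : weak_cover S x j -> x = r * j.
  case/weak_coverP=> s js def_x; suff -> : r = val s ^ j^-1.
    by rewrite def_x conjgE invgK -!mulgA mulVg mulg1.
  apply/eqP; apply: contraTT js => neq_r; apply/negP=> js.
  have le_sj : inv (j * val s) \subset inv j.
    by apply/subsetP=> z; rewrite inversions_down // => /andP[].
  have := min_j (j * val s); rewrite inE (subset_trans le_sj) //.
  rewrite inversions_down // rj neq_r le_sj => /(_ isT isT) eq_j.
  by have := right_inversionE j (reflections_gen s); rewrite js eq_j ltnn.
have [s js] := exists_descent j_neq1.
have cover_s : weak_cover S (j * val s) j by apply/weak_coverP; exists s.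
rewrite /lower_cover (_ : [set x | weak_cover S x j] = [set r * j]).
  exact: the_elt_set1.
apply/setP=> x; rewrite !inE; apply/idP/eqP=> [/coverE //|->].
by rewrite -(coverE _ cover_s).
Qed.

(** Inv(y) is Inv(ys) with the reflection of the cover added, so for z <= y the join of z and ys is
    ys or y according to whether z has that inversion. *)
Lemma weak_joinE y s : val s \in inv y^-1 ->
  [set z | weak_is_join S z (y * val s) y] = below_with y (val s ^ y^-1).
Proof.
move=> ys; apply/setP=> z; rewrite inE [in RHS]inE /weak_is_join !weak_leE.
have le_y : inv (y * val s) \subset inv y.
  by apply/subsetP=> r; rewrite inversions_down // => /andP[].
rewrite le_y /=; apply: andb_id2l => le_zy; apply/forallP/idP => [join|rz u].
  apply: contraT => not_rz; have := join (y * val s).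
  have -> : weak_le S z (y * val s).
    rewrite weak_leE; apply/subsetP=> r zr; rewrite inversions_down //.
    by rewrite (subsetP le_zy) //=; apply: contraNneq not_rz => <-.
  rewrite !weak_leE subxx /= => /subsetP/(_ (val s ^ y^-1)).
  by rewrite -inversionsV ys inversions_down // eqxx andbF => /(_ isT).
rewrite !weak_leE; apply/implyP=> le_zu; apply/implyP=> le_yu.
apply/subsetP=> r yr; have [->|neq_r] := eqVneq r (val s ^ y^-1).
  exact: subsetP rz.
by apply: (subsetP le_yu); rewrite inversions_down // yr.
Qed.

Lemma weak_minimalsP y r j :
  reflect (minimal_below y r j) (j \in weak_minimals S (below_with y r)).
Proof.
rewrite inE; apply: (iffP andP) => -[yj min_j]; split=> //.
  move=> z yz le_zj; apply/eqP; apply: contraT => neq_zj.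
  by have /forall_inP/(_ z yz) := min_j; rewrite weak_ltE neq_zj le_zj.
apply/forall_inP=> z yz; rewrite weak_ltE; apply/negP=> /andP[neq_zj le_zj].
by rewrite (min_j z) // eqxx in neq_zj.
Qed.

(** By uniqueness the set of minimal elements is a singleton, so [the_elt] does not return its
    default value. *)
Lemma shard_labelE y s j : val s \in inv y^-1 -> minimal_below y (val s ^ y^-1) j ->
  shard_label S (y * val s) y = j.
Proof.
move=> ys min_j; rewrite /shard_label weak_joinE // -[RHS]the_elt_set1.
congr the_elt; apply/setP=> z; rewrite in_set1.
apply/weak_minimalsP/eqP=> [min_z|-> //].
exact: minimal_below_unique min_z min_j.
Qed.

Lemma ascent_descent x s : val s \notin inv x^-1 ->
  val s \in inv (x * val s)^-1 /\ val s ^ (x * val s)^-1 = val s ^ x^-1.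
Proof.
move=> xs; split; first by rewrite inversions_mul_refl ?reflections_gen.
by rewrite invMg conjgM [val s ^ (val s)^-1]conjgE mulgV mulg1 invgK.
Qed.

Lemma minimal_below_label x s : val s \notin inv x^-1 ->
  exists2 j, minimal_below (x * val s) (val s ^ x^-1) j &
    shard_label S x (x * val s) = j /\
    braid_lift S (x * val s) * (braid_lift S x)^-1 =
    braid_lift S j * (braid_lift S (val s ^ x^-1 * j))^-1.
Proof.
move=> /ascent_descent[ys eq_r]; have [j] := minimal_below_lift ys.
rewrite eq_r => min_j; rewrite -mulgA gen_sq mulg1 => Bj.
exists j => //; split=> //.
by rewrite -(@shard_labelE (x * val s) s j) ?eq_r // -mulgA gen_sq mulg1.
Qed.

Lemma shard_label_refl x s : val s \notin inv x^-1 ->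
  shard_refl S (shard_label S x (x * val s)) = val s ^ x^-1.
Proof.
case/minimal_below_label=> j min_j [-> _].
have Tr : val s ^ x^-1 \in reflections S.
  by case: min_j => /setIdP[_ /inversions_reflection].
by rewrite /shard_refl (minimal_below_lower min_j) invMg mulKVg (refl_inv Tr).
Qed.

Lemma Sigma_shard_label x s : val s \notin inv x^-1 ->
  Sigma S (shard_label S x (x * val s)) =
  (braid_lift S (x * val s) * (braid_lift S x)^-1) ^+ 2.
Proof.
case/minimal_below_label=> j min_j [-> ->].
by rewrite /Sigma (minimal_below_lower min_j).
Qed.

(** * The longest element and loops of chambers *)

Lemma longest_inversions : inv (longest S) = reflections S.
Proof.
apply/setP=> r; apply/idP/idP => [/inversions_reflection // | Tr].
have max_len z : len z <= len (longest S).
  by rewrite /longest; case: arg_maxnP => // x _; apply.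
(* Otherwise the product of the inverse of the longest element and r would be longer than the
   longest element. *)
apply: contraT => not_r; have := inversions_mul_refl (longest S)^-1 Tr.
rewrite invgK not_r right_inversionE // -mulgA refl_order // mulg1 cox_lenV.
by rewrite ltnNge max_len.
Qed.

Lemma braid_liftM_gen x s : val s \notin inv x^-1 ->
  braid_lift S (x * val s) = braid_lift S x * braid_lift S (val s).
Proof.
move=> xs; apply: braid_liftM.
by rewrite cox_len_mul_gen (negPf xs) cox_len_gen addn1.
Qed.

(* The loop in the braid group that goes from the identity chamber to [w], from
   there to [x], and back to the identity chamber. *)
Definition chamber_loop w x : braid_group S :=
  braid_lift S w * braid_lift S (w^-1 * x) * (braid_lift S x)^-1.

(** If r = x s x^-1 is not an inversion of w, then s is an ascent of both x and w^-1 x, and the two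
    factors B(s) cancel. Otherwise s is a descent of w^-1 x, and the factors B(s) differ by B(x)
    B(s)^2 B(x)^-1, which is the square for this cover. *)
Lemma chamber_loop_step w x s : val s \notin inv x^-1 ->
  chamber_loop w x = chamber_loop w (x * val s) *
    if val s ^ x^-1 \in inv w then Sigma S (shard_label S x (x * val s)) else 1.
Proof.
move=> xs; rewrite /chamber_loop.
have wxs : (val s \in inv (w^-1 * x)^-1) = (val s ^ x^-1 \in inv w).
  by rewrite invMg invgK inversionsM (negPf xs).
case: ifP => rw; last first.
  rewrite (braid_liftM_gen xs) mulgA braid_liftM_gen ?wxs ?rw //.
  by rewrite invMg mulg1 !mulgA mulgK.
rewrite (Sigma_shard_label xs) expgS expg1 (braid_liftM_gen xs).
have def_wx : w^-1 * x = w^-1 * (x * val s) * val s by rewrite -!mulgA gen_sq mulg1.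
rewrite {1}def_wx braid_liftM_gen; last first.
  by rewrite [w^-1 * _]mulgA inversions_mul_refl ?reflections_gen // wxs rw.
by rewrite invMg !mulgA !mulgKV.
Qed.

(** Each step puts the loop at the next chamber to the left of its factor, hence the reversed
    product. The length hypothesis makes every step an ascent. *)
Lemma chamber_loop_path w x u : len (x * word_prod u) = (len x + size u)%N ->
  chamber_loop w x = chamber_loop w (x * word_prod u) *
    \prod_(j <- rev [seq j <- pairmap (shard_label S) x
                               (scanl *%g x [seq val s | s <- u])
                       | shard_refl S j \in inv w]) Sigma S j.
Proof.
elim: u x => [|s u IHu] x len_xu.
  by rewrite /= big_nil word_prod_nil !mulg1.
rewrite word_prod_cons mulgA in len_xu *.
have xs : val s \notin inv x^-1.
  apply/negP=> xs; have := cox_lenM_le (x * val s) (word_prod u).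
  rewrite len_xu leqNgt /= addnS ltnS => /negP[]; apply: leq_add (cox_len_le u).
  by rewrite cox_len_mul_gen xs leq_pred.
have len_xs : len (x * val s) = (len x).+1 by rewrite cox_len_mul_gen (negPf xs).
rewrite (chamber_loop_step w xs) IHu; last by rewrite len_xu len_xs addSnnS.
rewrite /= shard_label_refl // -mulgA; congr (_ * _).
case: ifP => _; last by rewrite mulg1.
by rewrite rev_cons -cats1 big_cat big_seq1.
Qed.

End Coxeter.

Theorem theorem3p9 (W : finGroupType) (S : {set W})
    (coxS : coxeter_system S) (irrS : cox_irreducible S)
    (w : W) (w0 : seq (gens S)) (w0_red : reduced_word w0 (longest S)) :
  braid_lift S w * braid_lift S (w^-1) = Z_prod w w0.
Proof.
have [/eqP Pw0 /eqP sz_w0] := andP w0_red.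
have := @chamber_loop_path _ _ coxS w 1 w0; rewrite cox_len1 // mul1g Pw0 -sz_w0.
rewrite -/(shard_word w0) -/(Z_shards w w0) -/(Z_prod w w0) => /(_ erefl).
rewrite /chamber_loop mulg1 braid_lift1 // invg1 mulg1 => ->.
(* This makes lengths add in w (w^-1 w0) = w0, so the loop at the longest element is trivial. *)
have w_le : weak_le S w (longest S).
  rewrite weak_leE // longest_inversions //.
  by apply/subsetP=> r /inversions_reflection.
by rewrite -(braid_liftM coxS) mulKVg ?mulgV ?mul1g //; apply/eqP.
Qed.
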